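(* We have $$t_n=n\log\left(1+\sqrt2\right)+o(1)\quad\text{and}\quad a(t_n)=4n\log\left(1+\sqrt2\right)-2\log 2+o(1)$$ as $n\to\infty$.
   Context: For each integer $n\ge 1$ and $t>0$, define $e(t),a(t),c(t)>0$ (depending on $n$) by $e(t)=4n\,\mathrm{arcsinh}(\coth t)$, $\cosh(a(t)/2)=\cosh(t)\cosh(e(t)/4)$, $\cosh(c(t)/2)=\sinh^2(e(t)/4)$. The number $t_n$ is the unique $t>0$ with $a(t)=c(t)$, and $a(t_n)$ is computed with the function $a$ associated with the same $n$. *)

(* Defs.v *)
From Stdlib Require Import Reals ClassicalEpsilon.
From Coquelicot Require Import Coquelicot.
Open Scope R_scope.

(* [the P] is the unique real satisfying [P]; it is an unspecified real
   when there is no such number or more than one. *)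
Definition the (P : R -> Prop) : R := epsilon (inhabits 0) (unique P).

Definition coth (t : R) : R := cosh t / sinh t.

(* The functions below are meaningful for [1 <= n] and [0 < t] only; their
   values outside this range are irrelevant junk. *)
Definition e (n : nat) (t : R) : R := 4 * INR n * arcsinh (coth t).

Definition a (n : nat) (t : R) : R :=
  the (fun x => 0 < x /\ cosh (x / 2) = cosh t * cosh (e n t / 4)).

Definition c (n : nat) (t : R) : R :=
  the (fun x => 0 < x /\ cosh (x / 2) = sinh (e n t / 4) ^ 2).

Definition t_ (n : nat) : R := the (fun t => 0 < t /\ a n t = c n t).

(* Main.v *)
Require Import Defs.
From Stdlib Require Import Reals Lra Lia ClassicalEpsilon.
From Stdlib Require Import Ranalysis5.
From Coquelicot Require Import Coquelicot.
Open Scope R_scope.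

(** Put [x = e n t / 4 = n arcsinh (coth t)].  Clearing the two defining
    equations, [a n t = c n t] says [cosh t * cosh x = sinh x ^ 2], that is
    [cosh t = cosh x - 1 / cosh x].  The left side increases with [t], while
    [x] decreases with [t] and [y - 1 / y] increases with [y], so there is at
    most one solution; there is one by the intermediate value theorem, and
    [t_ n] is then a genuine solution ([t_spec]).

    For the asymptotics let [L = ln (1 + sqrt 2) = arcsinh 1], and let [x] now
    be taken at [t = t_ n].  Three approximations are chained.
    - [cosh t = cosh x - 1 / cosh x] differs little from [cosh x], so [t] is
      close to [x] ([t_close]).
    - Since [coth t] is exponentially close to [1] and [arcsinh] is
      1-Lipschitz, [x] exceeds [n * L] by at most [2 * n / (exp (2 * t) - 1)]
      ([quarter_gt], [quarter_le]), which is small because [t] grows with [n].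
    - [cosh (a / 2) = sinh x ^ 2] is [exp (2 * x) / 4] up to a bounded error,
      so [a / 2] is close to [2 * x - ln 2] ([half_a_close]).
    In the first and the third the passage from [cosh] to its argument is the
    same: if [exp A] and [exp B] differ by a bounded amount then [A] and [B]
    differ by at most a constant times [exp (- A)] ([exponents_close]).  All errors come
    out bounded by a constant over [n]. *)

(** * Unique existence and hyperbolic functions *)

Lemma the_spec (P : R -> Prop) : (exists x, unique P x) -> P (the P).
Proof.
  intros H. unfold the.
  destruct (epsilon_spec (inhabits 0) (unique P) H) as [HP _]. exact HP.
Qed.

Lemma sinh_pos x : 0 < x -> 0 < sinh x.
Proof. intros H. rewrite <- sinh_0. now apply sinh_lt. Qed.

Lemma cosh_pos x : 0 < cosh x.
Proof. unfold cosh. pose proof (exp_pos x). pose proof (exp_pos (- x)). lra. Qed.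

Lemma exp_nondecreasing x y : x <= y -> exp x <= exp y.
Proof.
  intros [H | <-]; [left; now apply exp_increasing | right; reflexivity].
Qed.

Lemma exp_mult_opp x : exp x * exp (- x) = 1.
Proof. rewrite <- exp_plus, Rplus_opp_r. apply exp_0. Qed.

Lemma cosh_sq x : cosh x ^ 2 = 1 + sinh x ^ 2.
Proof. unfold cosh, sinh. pose proof (exp_mult_opp x). nra. Qed.

Lemma cosh_ge_1 x : 1 <= cosh x.
Proof.
  pose proof (cosh_sq x). pose proof (cosh_pos x).
  pose proof (pow2_ge_0 (sinh x)). nra.
Qed.

Lemma cosh_lt x y : 0 <= x -> x < y -> cosh x < cosh y.
Proof.
  intros Hx Hxy.
  assert (0 <= sinh x).
  { destruct Hx as [Hx | <-]; [left; now apply sinh_pos | rewrite sinh_0; lra]. }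
  pose proof (sinh_lt x y Hxy). pose proof (cosh_sq x). pose proof (cosh_sq y).
  pose proof (cosh_pos x). pose proof (cosh_pos y). nra.
Qed.

Lemma cosh_le x y : 0 <= x -> x <= y -> cosh x <= cosh y.
Proof.
  intros Hx [Hxy | <-]; [left; now apply cosh_lt | right; reflexivity].
Qed.

Lemma cosh_inj x y : 0 <= x -> 0 <= y -> cosh x = cosh y -> x = y.
Proof.
  intros Hx Hy E. destruct (Rtotal_order x y) as [H | [H | H]]; [| exact H |].
  - pose proof (cosh_lt x y Hx H). lra.
  - pose proof (cosh_lt y x Hy H). lra.
Qed.

Lemma cosh_half_inverse y :
  1 < y -> exists x, unique (fun x => 0 < x /\ cosh (x / 2) = y) x.
Proof.
  intros Hy.
  assert (Hs : 0 < sqrt (y ^ 2 - 1)) by (apply sqrt_lt_R0; nra).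
  exists (2 * arcsinh (sqrt (y ^ 2 - 1))). split.
  - split.
    + pose proof (arcsinh_lt _ _ Hs) as H. rewrite arcsinh_0 in H. lra.
    + replace (2 * arcsinh (sqrt (y ^ 2 - 1)) / 2)
        with (arcsinh (sqrt (y ^ 2 - 1))) by field.
      pose proof (cosh_sq (arcsinh (sqrt (y ^ 2 - 1)))) as H.
      rewrite sinh_arcsinh, pow2_sqrt in H by nra.
      pose proof (cosh_pos (arcsinh (sqrt (y ^ 2 - 1)))). nra.
  - intros x [Hx E].
    assert (Hh : x / 2 = arcsinh (sqrt (y ^ 2 - 1))); [| lra].
    rewrite <- (arcsinh_sinh (x / 2)). f_equal.
    apply Rsqr_inj.
    + left. apply sinh_pos. lra.
    + lra.
    + rewrite Rsqr_sqrt by nra. unfold Rsqr.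
      pose proof (cosh_sq (x / 2)) as H. rewrite E in H. lra.
Qed.

Lemma arcsinh_1 : arcsinh 1 = ln (1 + sqrt 2).
Proof. unfold arcsinh. do 3 f_equal. ring. Qed.

(** The derivative [cosh] of the inverse function is at least 1. *)
Lemma arcsinh_lipschitz y z : y < z -> arcsinh z - arcsinh y <= z - y.
Proof.
  intros H. pose proof (arcsinh_lt y z H) as Hlt.
  destruct (MVT_cor2 sinh cosh _ _ Hlt) as [d [E _]].
  { intros d _. apply derivable_pt_lim_sinh. }
  rewrite !sinh_arcsinh in E. pose proof (cosh_ge_1 d). nra.
Qed.

Lemma coth_gt_1 t : 0 < t -> 1 < coth t.
Proof.
  intros Ht. unfold coth. pose proof (sinh_pos t Ht).
  apply -> Rlt_div_r; [| assumption].
  unfold cosh, sinh. pose proof (exp_pos (- t)). lra.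
Qed.

Lemma coth_lt s t : 0 < s -> s < t -> coth t < coth s.
Proof.
  intros Hs Hst. unfold coth.
  pose proof (sinh_pos s Hs). pose proof (sinh_pos t (Rlt_trans _ _ _ Hs Hst)).
  pose proof (sinh_pos (t - s) ltac:(lra)) as Hd.
  assert (E : sinh (t - s) = sinh t * cosh s - cosh t * sinh s).
  { unfold sinh, cosh. replace (- (t - s)) with (- t + s) by ring.
    replace (t - s) with (t + - s) by ring. rewrite !exp_plus. field. }
  apply <- Rlt_div_l; [| assumption].
  replace (cosh s / sinh s * sinh t) with (cosh s * sinh t / sinh s)
    by (field; lra).
  apply -> Rlt_div_r; [| assumption]. lra.
Qed.

Lemma coth_minus_1 t : 0 < t -> coth t - 1 = 2 / (exp t ^ 2 - 1).
Proof.
  intros Ht. pose proof (exp_ineq1_le t). pose proof (exp_pos t).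
  unfold coth, cosh, sinh. rewrite exp_Ropp. field.
  repeat split; nra.
Qed.

(** * The equation for [t_ n] *)

Definition quarter (n : nat) (t : R) : R := INR n * arcsinh (coth t).

Lemma e_quarter n t : e n t / 4 = quarter n t.
Proof. unfold e, quarter. field. Qed.

Lemma quarter_gt n t :
  (1 <= n)%nat -> 0 < t -> INR n * ln (1 + sqrt 2) < quarter n t.
Proof.
  intros Hn Ht. unfold quarter. rewrite <- arcsinh_1.
  apply Rmult_lt_compat_l; [apply lt_0_INR; lia |].
  now apply arcsinh_lt, coth_gt_1.
Qed.

Lemma quarter_le n t :
  0 < t ->
  quarter n t <= INR n * ln (1 + sqrt 2) + INR n * (2 / (exp t ^ 2 - 1)).
Proof.
  intros Ht. unfold quarter. rewrite <- arcsinh_1, <- coth_minus_1 by assumption.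
  pose proof (arcsinh_lipschitz 1 (coth t) (coth_gt_1 t Ht)).
  pose proof (pos_INR n). nra.
Qed.

Lemma quarter_lt n s t :
  (1 <= n)%nat -> 0 < s -> s < t -> quarter n t < quarter n s.
Proof.
  intros Hn Hs Hst. unfold quarter.
  apply Rmult_lt_compat_l; [apply lt_0_INR; lia |].
  now apply arcsinh_lt, coth_lt.
Qed.

Lemma arcsinh_coth_le_quarter n t :
  (1 <= n)%nat -> 0 < t -> arcsinh (coth t) <= quarter n t.
Proof.
  intros Hn Ht. unfold quarter. apply le_INR in Hn. simpl in Hn.
  pose proof (coth_gt_1 t Ht).
  assert (H0 : 0 < arcsinh (coth t)) by (rewrite <- arcsinh_0; apply arcsinh_lt; lra).
  nra.
Qed.

Lemma quarter_pos n t : (1 <= n)%nat -> 0 < t -> 0 < quarter n t.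
Proof.
  intros Hn Ht. apply Rlt_le_trans with (2 := arcsinh_coth_le_quarter n t Hn Ht).
  pose proof (coth_gt_1 t Ht). rewrite <- arcsinh_0. apply arcsinh_lt. lra.
Qed.

Lemma sinh_quarter_gt_1 n t : (1 <= n)%nat -> 0 < t -> 1 < sinh (quarter n t).
Proof.
  intros Hn Ht. apply Rlt_le_trans with (1 := coth_gt_1 t Ht).
  rewrite <- (sinh_arcsinh (coth t)) at 1.
  destruct (arcsinh_coth_le_quarter n t Hn Ht) as [H | <-];
    [left; now apply sinh_lt | lra].
Qed.

Lemma a_spec n t :
  (1 <= n)%nat -> 0 < t ->
  0 < a n t /\ cosh (a n t / 2) = cosh t * cosh (quarter n t).
Proof.
  intros Hn Ht. rewrite <- e_quarter. apply (the_spec (fun x => 0 < x /\ cosh (x / 2) = _)).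
  apply cosh_half_inverse.
  pose proof (cosh_lt 0 t ltac:(lra) Ht) as H. rewrite cosh_0 in H.
  pose proof (cosh_ge_1 (e n t / 4)). nra.
Qed.

Lemma c_spec n t :
  (1 <= n)%nat -> 0 < t ->
  0 < c n t /\ cosh (c n t / 2) = sinh (quarter n t) ^ 2.
Proof.
  intros Hn Ht. rewrite <- e_quarter. apply (the_spec (fun x => 0 < x /\ cosh (x / 2) = _)).
  apply cosh_half_inverse.
  pose proof (sinh_quarter_gt_1 n t Hn Ht) as H. rewrite <- e_quarter in H. nra.
Qed.

(** The defect of the equation [a n t = c n t], in the form in which it is
    visibly monotone in [t]. *)
Definition defect (n : nat) (t : R) : R :=
  cosh t - (cosh (quarter n t) - / cosh (quarter n t)).

Lemma a_eq_c_iff n t :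
  (1 <= n)%nat -> 0 < t -> a n t = c n t <-> defect n t = 0.
Proof.
  intros Hn Ht.
  destruct (a_spec n t Hn Ht) as [Ha Ea]. destruct (c_spec n t Hn Ht) as [Hc Ec].
  assert (E : defect n t * cosh (quarter n t)
              = cosh (a n t / 2) - cosh (c n t / 2)).
  { rewrite Ea, Ec. unfold defect.
    pose proof (cosh_pos (quarter n t)). pose proof (cosh_sq (quarter n t)) as H1.
    replace (sinh (quarter n t) ^ 2) with (cosh (quarter n t) ^ 2 - 1) by lra.
    field. lra. }
  pose proof (cosh_pos (quarter n t)). split; intros H1.
  - rewrite H1 in E. apply Rmult_eq_reg_r with (cosh (quarter n t)); lra.
  - rewrite H1 in E. assert (a n t / 2 = c n t / 2); [| lra].
    apply cosh_inj; lra.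
Qed.

Lemma defect_lt n s t :
  (1 <= n)%nat -> 0 < s -> s < t -> defect n s < defect n t.
Proof.
  intros Hn Hs Hst. unfold defect.
  pose proof (cosh_lt s t ltac:(lra) Hst).
  pose proof (quarter_pos n t Hn ltac:(lra)) as H0.
  pose proof (cosh_lt _ _ (Rlt_le _ _ H0) (quarter_lt n s t Hn Hs Hst)) as Hq.
  pose proof (Rinv_lt_contravar _ _
    (Rmult_lt_0_compat _ _ (cosh_pos (quarter n t)) (cosh_pos (quarter n s))) Hq).
  lra.
Qed.

Lemma continuity_pt_defect n t : 0 < t -> continuity_pt (defect n) t.
Proof.
  intros Ht. apply derivable_continuous_pt.
  assert (Hq : derivable_pt (quarter n) t).
  { apply derivable_pt_scal with (f := fun t => arcsinh (coth t)).
    apply (derivable_pt_comp coth arcsinh).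
    - apply derivable_pt_div;
        [apply derivable_pt_cosh | apply derivable_pt_sinh |].
      pose proof (sinh_pos t Ht). lra.
    - eexists. apply derivable_pt_lim_arcsinh. }
  assert (Hc : derivable_pt (fun t => cosh (quarter n t)) t).
  { apply (derivable_pt_comp (quarter n) cosh); [exact Hq |].
    apply derivable_pt_cosh. }
  apply derivable_pt_minus; [apply derivable_pt_cosh |].
  apply derivable_pt_minus; [exact Hc |].
  apply derivable_pt_inv; [| exact Hc].
  pose proof (cosh_pos (quarter n t)). lra.
Qed.

(** At [sinh t = 1 / 2] the bound [cosh x >= sinh x >= coth t] makes the defect
    at most [cosh t - 1 / (sinh t * cosh t)], which is negative. *)
Lemma defect_neg_arcsinh_half n : (1 <= n)%nat -> defect n (arcsinh (/ 2)) < 0.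
Proof.
  intros Hn. set (s := arcsinh (/ 2)).
  assert (Hs : 0 < s).
  { rewrite <- arcsinh_0. apply arcsinh_lt. lra. }
  assert (Es : sinh s = / 2) by apply sinh_arcsinh.
  pose proof (cosh_sq s) as Ec. pose proof (cosh_pos s) as Hc. rewrite Es in Ec.
  assert (Hq : 2 * cosh s <= cosh (quarter n s)).
  { apply Rle_trans with (cosh (arcsinh (coth s))).
    - pose proof (cosh_sq (arcsinh (coth s))) as H. rewrite sinh_arcsinh in H.
      replace (coth s) with (2 * cosh s) in H |- * by (unfold coth; rewrite Es; field).
      pose proof (cosh_pos (arcsinh (2 * cosh s))). nra.
    - apply cosh_le; [| now apply arcsinh_coth_le_quarter].
      rewrite <- arcsinh_0. apply arcsinh_le. pose proof (coth_gt_1 s Hs). lra. }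
  assert (Hi : / cosh (quarter n s) <= / (2 * cosh s)).
  { apply Rinv_le_contravar; lra. }
  assert (/ (2 * cosh s) < cosh s).
  { apply Rmult_lt_reg_l with (2 * cosh s); [lra |]. rewrite Rinv_r by lra. nra. }
  unfold defect. lra.
Qed.

Lemma defect_pos n t :
  (1 <= n)%nat -> 0 < t -> quarter n t <= t -> 0 < defect n t.
Proof.
  intros Hn Ht Hq. unfold defect. pose proof (quarter_pos n t Hn Ht) as H0.
  pose proof (cosh_le _ _ (Rlt_le _ _ H0) Hq).
  pose proof (Rinv_0_lt_compat _ (cosh_pos (quarter n t))). lra.
Qed.

Lemma defect_root n : (1 <= n)%nat -> exists t, 0 < t /\ defect n t = 0.
Proof.
  intros Hn. set (s := arcsinh (/ 2)).
  assert (Hs : 0 < s).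
  { rewrite <- arcsinh_0. apply arcsinh_lt. lra. }
  pose proof (quarter_pos n s Hn Hs) as Hq.
  (* As [quarter n] decreases, its value at [s + quarter n s] is below
     [quarter n s]. *)
  pose proof (quarter_lt n s (s + quarter n s) Hn Hs ltac:(lra)).
  destruct (IVT_interv (defect n) s (s + quarter n s)) as [t [Ht E]].
  - intros r Hr. apply continuity_pt_defect. lra.
  - lra.
  - now apply defect_neg_arcsinh_half.
  - apply defect_pos; [exact Hn | lra | lra].
  - exists t. split; [lra | exact E].
Qed.

Lemma t_spec n : (1 <= n)%nat -> 0 < t_ n /\ defect n (t_ n) = 0.
Proof.
  intros Hn.
  assert (H : 0 < t_ n /\ a n (t_ n) = c n (t_ n)).
  { apply (the_spec (fun t => 0 < t /\ a n t = c n t)).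
    destruct (defect_root n Hn) as [t [Ht E]]. exists t. split.
    - split; [exact Ht | now apply a_eq_c_iff].
    - intros s [Hs Es]. apply a_eq_c_iff in Es; [| assumption ..].
      destruct (Rtotal_order t s) as [H | [H | H]]; [| exact H |].
      + pose proof (defect_lt n t s Hn Ht H). lra.
      + pose proof (defect_lt n s t Hn Hs H). lra. }
  destruct H as [Ht E]. split; [exact Ht | now apply a_eq_c_iff].
Qed.

(** * Asymptotics *)

(** With [D = B - A], dividing by [exp A] gives
    [1 <= exp D <= 1 + k * exp (- A)], and [1 + D <= exp D]. *)
Lemma exponents_close A B k m :
  0 <= k -> 0 < m -> m <= exp A -> exp A <= exp B -> exp B - k <= exp A ->
  0 <= B - A <= k / m.
Proof.
  intros Hk Hm HA H1 H2. split.
  - destruct H1 as [H1 | H1].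
    + apply exp_lt_inv in H1. lra.
    + apply exp_inv in H1. lra.
  - pose proof (exp_ineq1_le (B - A)) as H.
    assert (E : exp (B - A) * exp A = exp B).
    { rewrite <- exp_plus. f_equal. ring. }
    apply -> Rle_div_r; [| exact Hm].
    assert (0 <= exp (B - A) - 1).
    { apply Rmult_le_reg_r with (exp A); [apply exp_pos | lra]. }
    nra.
Qed.

(** The surplus 4 keeps [exp (t_ n) >= exp x - 3] above [n + 1], as needed in
    [quarter_close]; the restriction [3 <= n] is where [2 ^ n >= n + 4]
    starts. *)
Lemma exp_growth n :
  (3 <= n)%nat -> INR n + 4 <= exp (INR n * ln (1 + sqrt 2)).
Proof.
  intros Hn. apply Rle_trans with (2 ^ n).
  - induction Hn as [| n Hn IH]; [simpl; lra |].
    apply le_INR in Hn. simpl in Hn. rewrite S_INR. simpl. lra.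
  - rewrite <- Rpower_pow by lra. unfold Rpower. apply exp_nondecreasing.
    apply Rmult_le_compat_l; [apply pos_INR |].
    apply ln_le; [lra |]. pose proof (sqrt_le_1 1 2). rewrite sqrt_1 in H. lra.
Qed.

Lemma exp_quarter_t n :
  (3 <= n)%nat -> INR n + 4 <= exp (quarter n (t_ n)).
Proof.
  intros Hn. apply Rle_trans with (1 := exp_growth n Hn).
  left. apply exp_increasing, quarter_gt; [lia |]. apply t_spec. lia.
Qed.

(** In [cosh t = cosh x - 1 / cosh x] with [t, x > 0], each of [exp (- t)],
    [exp (- x)] and [1 / cosh x] lies between 0 and 1; the last one counts
    twice after multiplying by 2, whence the constant 3. *)
Lemma exp_t_bounds n :
  (1 <= n)%nat ->
  exp (quarter n (t_ n)) - 3 <= exp (t_ n) <= exp (quarter n (t_ n)).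
Proof.
  intros Hn. destruct (t_spec n Hn) as [Ht E]. unfold defect in E.
  set (q := quarter n (t_ n)) in *.
  assert (Hq : 0 < q) by now apply quarter_pos.
  pose proof (cosh_ge_1 q).
  assert (/ cosh q <= 1) by (rewrite <- Rinv_1; apply Rinv_le_contravar; lra).
  pose proof (Rinv_0_lt_compat _ (cosh_pos q)).
  split.
  - pose proof (exp_pos (- q)).
    assert (exp (- t_ n) < 1) by (rewrite <- exp_0; apply exp_increasing; lra).
    unfold cosh at 1 2 in E. lra.
  - apply exp_nondecreasing. destruct (Rle_or_lt (t_ n) q) as [H2 | H2]; [exact H2 |].
    pose proof (cosh_lt q (t_ n) ltac:(lra) H2). lra.
Qed.

Lemma t_close n :
  (3 <= n)%nat -> 0 <= quarter n (t_ n) - t_ n <= 3 / INR n.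
Proof.
  intros Hn. pose proof (exp_quarter_t n Hn).
  destruct (exp_t_bounds n ltac:(lia)).
  assert (0 < INR n) by (apply lt_0_INR; lia).
  apply exponents_close; lra.
Qed.

Lemma quarter_close n :
  (3 <= n)%nat ->
  0 <= quarter n (t_ n) - INR n * ln (1 + sqrt 2) <= 2 / INR n.
Proof.
  intros Hn. destruct (t_spec n ltac:(lia)) as [Ht _].
  pose proof (quarter_gt n (t_ n) ltac:(lia) Ht).
  pose proof (quarter_le n (t_ n) Ht).
  pose proof (exp_quarter_t n Hn). destruct (exp_t_bounds n ltac:(lia)).
  assert (0 < INR n) by (apply lt_0_INR; lia).
  assert (INR n * (2 / (exp (t_ n) ^ 2 - 1)) <= 2 / INR n); [| lra].
  (* [exp t >= n + 1], hence [exp t ^ 2 - 1 >= n ^ 2]. *)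
  apply Rle_trans with (INR n * (2 / INR n ^ 2)); [| right; field; lra].
  apply Rmult_le_compat_l; [lra |]. apply Rmult_le_compat_l; [lra |].
  apply Rinv_le_contravar; nra.
Qed.

(** With [h = a / 2], doubling [cosh h = sinh x ^ 2] gives
    [exp h + exp (- h) = exp (2 * x) / 2 - 1 + exp (- 2 * x) / 2], so [exp h]
    is below [exp (2 * x) / 2 = exp (2 * x - ln 2)], but by at most 2. *)
Lemma half_a_close n :
  (3 <= n)%nat ->
  0 <= 2 * quarter n (t_ n) - ln 2 - a n (t_ n) / 2 <= 2 / INR n.
Proof.
  intros Hn. destruct (t_spec n ltac:(lia)) as [Ht E].
  pose proof (exp_quarter_t n Hn) as Hg.
  assert (Hp : 0 < INR n) by (apply lt_0_INR; lia).
  destruct (c_spec n (t_ n) ltac:(lia) Ht) as [Hc Ec].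
  apply a_eq_c_iff in E; [| lia | exact Ht]. rewrite <- E in Hc, Ec.
  set (q := quarter n (t_ n)) in *. set (h := a n (t_ n) / 2) in *.
  assert (EB : exp (2 * q - ln 2) = exp q ^ 2 / 2).
  { unfold Rminus. rewrite exp_plus, exp_Ropp, exp_ln by lra.
    replace (2 * q) with (q + q) by ring. rewrite exp_plus. field. }
  assert (Eh : (exp h + exp (- h)) / 2 = (exp q ^ 2 - 2 + exp (- q) ^ 2) / 4).
  { fold (cosh h). rewrite Ec. unfold sinh. pose proof (exp_mult_opp q). nra. }
  pose proof (exp_pos (- h)).
  assert (exp (- h) < 1).
  { rewrite <- exp_0. apply exp_increasing. unfold h. lra. }
  assert (0 < exp (- q) < 1).
  { split; [apply exp_pos |]. rewrite <- exp_0. apply exp_increasing.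
    assert (0 < q) by (apply quarter_pos; [lia | exact Ht]). lra. }
  apply exponents_close; try rewrite EB; nra.
Qed.

Lemma is_lim_seq_0_of_inv_bound (u : nat -> R) K :
  (forall n, (3 <= n)%nat -> Rabs (u n) <= K / INR n) -> is_lim_seq u 0.
Proof.
  intros H. apply is_lim_seq_abs_0.
  apply is_lim_seq_le_le_loc with (fun _ => 0) (fun n => K * / INR n).
  - exists 3%nat. intros n Hn. split; [apply Rabs_pos | now apply H].
  - apply is_lim_seq_const.
  - replace (Finite 0) with (Rbar_mult K 0) by (simpl; f_equal; ring).
    apply is_lim_seq_scal_l.
    apply (is_lim_seq_inv INR p_infty); [apply is_lim_seq_INR | discriminate].
Qed.

Theorem lemma6p1 :
  is_lim_seq (fun n : nat => t_ n - INR n * ln (1 + sqrt 2)) 0 /\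
  is_lim_seq
    (fun n : nat => a n (t_ n) - (4 * INR n * ln (1 + sqrt 2) - 2 * ln 2)) 0.
Proof.
  split.
  - apply is_lim_seq_0_of_inv_bound with 3. intros n Hn.
    pose proof (t_close n Hn). pose proof (quarter_close n Hn).
    unfold Rdiv in *. assert (0 < / INR n) by (apply Rinv_0_lt_compat, lt_0_INR; lia).
    apply Rabs_le. lra.
  - apply is_lim_seq_0_of_inv_bound with 8. intros n Hn.
    pose proof (half_a_close n Hn). pose proof (quarter_close n Hn).
    unfold Rdiv in *. assert (0 < / INR n) by (apply Rinv_0_lt_compat, lt_0_INR; lia).
    apply Rabs_le. lra.
Qed.
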